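(* Let $\tilde A_i=(a_i;\,l_i^{\mu L},r_i^{\mu L},l_i^{\mu U},r_i^{\mu U};\,l_i^{\nu L},r_i^{\nu L},l_i^{\nu U},r_i^{\nu U})_{LR}$, $i=1,2$, be $LR$-type IVIFNs with the same shape functions, where $a_1-l_1^{\nu L}\ge0$, and $\tilde A_2$ is arbitrary. Then $\tilde A_1\odot\tilde A_2=(a;\,l^{\mu L},r^{\mu L},l^{\mu U},r^{\mu U};\,l^{\nu L},r^{\nu L},l^{\nu U},r^{\nu U})_{LR}$, where $a=a_1a_2$ and, for each $\kappa\in\{\mu L,\mu U,\nu L,\nu U\}$, $$l^\kappa=a_1a_2-\min\{(a_1-l_1^\kappa)(a_2-l_2^\kappa),(a_1+r_1^\kappa)(a_2-l_2^\kappa)\},\quad r^\kappa=\max\{(a_1-l_1^\kappa)(a_2+r_2^\kappa),(a_1+r_1^\kappa)(a_2+r_2^\kappa)\}-a_1a_2.$$ Moreover the conditions for an $LR$-type representation hold: all eight spreads of the product are positive and $l^{\mu U}\ge l^{\mu L}$, $l^{\nu L}\ge l^{\nu U}$, $l^{\nu L}\ge l^{\mu L}$, $l^{\nu U}\ge l^{\mu U}$, and likewise with $r$ in place of $l$.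
   Context: A shape function is a continuous, strictly decreasing, invertible $f:[0,\infty)\to[0,1]$ with $f(0)=1$ and $\lim_{x\to\infty}f(x)=0$. Fix shape functions $L,R,L',R'$. An $LR$-type interval-valued intuitionistic fuzzy number (IVIFN) is written $\tilde A=(a;l^{\mu L},r^{\mu L},l^{\mu U},r^{\mu U};l^{\nu L},r^{\nu L},l^{\nu U},r^{\nu U})_{LR}$, where $a\in\mathbb R$ is its mean value and the eight spreads are positive reals with $l^{\mu U}\ge l^{\mu L}$, $r^{\mu U}\ge r^{\mu L}$, $l^{\nu L}\ge l^{\nu U}$, $r^{\nu L}\ge r^{\nu U}$, $l^{\nu L}\ge l^{\mu L}$, $r^{\nu L}\ge r^{\mu L}$, $l^{\nu U}\ge l^{\mu U}$, $r^{\nu U}\ge r^{\mu U}$. It encodes a lower membership function equal to $L((a-x)/l^{\mu L})$ on $[a-l^{\mu L},a]$, $R((x-a)/r^{\mu L})$ on $[a,a+r^{\mu L}]$, and $0$ otherwise; an upper membership function of the same form with $L',R',l^{\mu U},r^{\mu U}$; a lower non-membership function equal to $1-L((a-x)/l^{\nu L})$ on $[a-l^{\nu L},a]$, $1-R((x-a)/r^{\nu L})$ on $[a,a+r^{\nu L}]$, and $1$ otherwise; and an upper non-membership function of the same form with $L',R',l^{\nu U},r^{\nu U}$. At each $x$ the supremum of the membership interval plus the supremum of the non-membership interval is at most $1$. The product $\tilde A_1\odot\tilde A_2$ is formed cutwise by interval multiplication and read off at the level where the inverse shape functions equal $0$ (giving the mean) and at the level where they equal $1$ (giving the spreads). That is,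 it is the tuple (with the same shape functions) with mean $a=a_1a_2$ and spreads determined, for each $\kappa\in\{\mu L,\mu U,\nu L,\nu U\}$, by $$[a-l^{\kappa},a+r^{\kappa}]=[a_1-l_1^{\kappa},a_1+r_1^{\kappa}]\times[a_2-l_2^{\kappa},a_2+r_2^{\kappa}],$$ where $I\times J=\{xy:x\in I,y\in J\}$. *)

(* Defs.v *)
From mathcomp Require Import all_boot all_order all_algebra.
From mathcomp Require Import all_classical all_reals all_analysis.
Set Implicit Arguments.
Unset Strict Implicit.
Unset Printing Implicit Defensive.
Import Order.TTheory GRing.Theory Num.Theory numFieldNormedType.Exports.
Local Open Scope classical_set_scope.
Local Open Scope ring_scope.

(* Functions on [0, +oo[ are modelled by functions on the whole line whose
   values at negative arguments are unconstrained (and never used).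
   Being strictly decreasing with limit 0, a shape function never takes the
   value 0: "invertible" can only mean invertible onto its range ]0, 1]. *)
Record shape_function (K : realType) (f : K -> K) : Prop := ShapeFunction {
  shape_cont : {within `[0, +oo[%classic, continuous f};
  shape_range : forall x : K, 0 <= x -> 0 <= f x <= 1;
  shape_decr : forall x y : K, 0 <= x -> x < y -> f y < f x;
  shape_bij : set_bij `[0, +oo[%classic `]0, 1]%classic f;
  shape_at0 : f 0 = 1;
  shape_lim : f x @[x --> +oo] --> (0 : K)
}.

Record lr_tuple (K : realType) := LRTuple {
  mean : K;
  l_muL : K; r_muL : K; l_muU : K; r_muU : K;
  l_nuL : K; r_nuL : K; l_nuU : K; r_nuU : K
}.

Inductive component := muL | muU | nuL | nuU.

Definition lspread (K : realType) (A : lr_tuple K) (k : component) : K :=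
  match k with
  | muL => l_muL A | muU => l_muU A | nuL => l_nuL A | nuU => l_nuU A
  end.

Definition rspread (K : realType) (A : lr_tuple K) (k : component) : K :=
  match k with
  | muL => r_muL A | muU => r_muU A | nuL => r_nuL A | nuU => r_nuU A
  end.

(* The first two branches overlap only at x = a, where both give f 0 = g 0
   for shape functions f and g. *)
Definition lr_membership (K : realType) (f g : K -> K) (a l r x : K) : K :=
  if a - l <= x <= a then f ((a - x) / l)
  else if a <= x <= a + r then g ((x - a) / r)
  else 0.

Definition lr_nonmembership (K : realType) (f g : K -> K) (a l r x : K) : K :=
  if a - l <= x <= a then 1 - f ((a - x) / l)
  else if a <= x <= a + r then 1 - g ((x - a) / r)
  else 1.

Definition encoded_function (K : realType) (L R L' R' : K -> K)
    (A : lr_tuple K) (k : component) : K -> K :=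
  match k with
  | muL => lr_membership L R (mean A) (lspread A muL) (rspread A muL)
  | muU => lr_membership L' R' (mean A) (lspread A muU) (rspread A muU)
  | nuL => lr_nonmembership L R (mean A) (lspread A nuL) (rspread A nuL)
  | nuU => lr_nonmembership L' R' (mean A) (lspread A nuU) (rspread A nuU)
  end.

Definition spread_conditions (K : realType) (s : component -> K) : Prop :=
  [/\ forall k, 0 < s k,
      s muL <= s muU, s nuU <= s nuL, s muL <= s nuL & s muU <= s nuU].

(* The suprema of the membership and non-membership intervals at x are the
   values at x of the two upper functions; L, R are not compared with L', R'. *)
Record is_LR_ivifn (K : realType) (L R L' R' : K -> K)
    (A : lr_tuple K) : Prop := IsLRIvifn {
  ivifn_l : spread_conditions (lspread A);
  ivifn_r : spread_conditions (rspread A);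
  ivifn_sup : forall x : K, encoded_function L R L' R' A muU x +
                            encoded_function L R L' R' A nuU x <= 1
}.

Definition base_interval (K : realType) (A : lr_tuple K)
    (k : component) : set K :=
  `[mean A - lspread A k, mean A + rspread A k]%classic.

(* Cutwise interval multiplication, read off where the inverse shape functions
   equal 0 (the cuts are the means) and where they equal 1 (the cuts are the
   base intervals). *)
Definition is_product (K : realType) (A1 A2 B : lr_tuple K) : Prop :=
  mean B = mean A1 * mean A2 /\
  forall k, base_interval B k =
    [set x * y | x in base_interval A1 k & y in base_interval A2 k].

(* Main.v *)
(** For a fixed second factor [y] the product [x * y] is affine in [x], so over
    a nonnegative interval [u, v] its extrema lie at [u] or [v]; for a fixed
    [x >= 0] it is monotone in [y]. This yields the endpoints of the product
    interval, and moving one factor at a time from the minimizing corner to the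
    maximizing one reaches every value in between. The order of the spreads is
    the inclusion of the nested factor intervals, and it bounds the sum of the
    two upper functions because shape functions decrease. *)
Require Import Defs.
From mathcomp Require Import all_boot all_order all_algebra.
From mathcomp Require Import all_classical all_reals all_analysis.
From mathcomp Require Import lra.
Set Implicit Arguments.
Unset Strict Implicit.
Unset Printing Implicit Defensive.
Import Order.TTheory GRing.Theory Num.Theory numFieldNormedType.Exports.
Local Open Scope ring_scope.

(** An explicit intermediate value theorem: [c * (p + s * (q - p))] is affine in [s], so solving for
    [s] gives a ratio, except when both end values agree and any [s] serves. The sign of [c] is
    free, as an endpoint of the second factor may be negative. *)
Lemma mul_convex_ivt (K : realFieldType) (c p q t : K) :
  c * p <= t <= c * q ->
  exists2 s, 0 <= s <= 1 & c * (p + s * (q - p)) = t.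
Proof.
move=> /andP[cpt tcq]; have [cpq|cpq] := eqVneq (c * p) (c * q).
  exists 0; first by rewrite lexx ler01.
  by rewrite mul0r addr0; apply/eqP; rewrite eq_le cpt cpq tcq.
have d0 : 0 < c * q - c * p.
  by rewrite subr_gt0 lt_neqAle cpq (le_trans cpt tcq).
exists ((t - c * p) / (c * q - c * p)).
  by rewrite divr_ge0 ?subr_ge0 ?(le_trans cpt) // ler_pdivrMr // mul1r lerD2r.
by rewrite mulrDr mulrCA mulrBr divfK ?gt_eqF// addrC subrK.
Qed.

Lemma convex_itv (K : realFieldType) (a b p q s : K) :
  a <= p <= b -> a <= q <= b -> 0 <= s <= 1 -> a <= p + s * (q - p) <= b.
Proof. by move=> /andP[? ?] /andP[? ?] /andP[? ?]; apply/andP; split; nra. Qed.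

(** Since [0 <= x], [x * w <= x * y]; the sign of [w] then decides whether [u] or [v] minimizes
    [x * w]. *)
Lemma mul_ge_min_endpoints (K : realFieldType) (u v w x y : K) :
  0 <= u -> u <= x <= v -> w <= y -> Num.min (u * w) (v * w) <= x * y.
Proof.
move=> u0 /andP[ux xv] wy; rewrite ge_min.
by case: (leP 0 w) => w0; apply/orP; [left|right]; nra.
Qed.

Lemma mul_le_max_endpoints (K : realFieldType) (u v z x y : K) :
  0 <= u -> u <= x <= v -> y <= z -> x * y <= Num.max (u * z) (v * z).
Proof.
move=> u0 /andP[ux xv] yz; rewrite le_max.
by case: (leP 0 z) => z0; apply/orP; [right|left]; nra.
Qed.

Lemma itv_mul (K : realType) (u v w z : K) : 0 <= u -> u <= v -> w <= z ->
  [set x * y | x in `[u, v]%classic & y in `[w, z]%classic]%classic =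
  `[Num.min (u * w) (v * w), Num.max (u * z) (v * z)]%classic.
Proof.
move=> u0 uv wz; apply/seteqP; split => [_ [x + [y + <-]]|t]; rewrite /= !in_itv /=.
  move=> xuv /andP[wy yz].
  by rewrite mul_ge_min_endpoints ?mul_le_max_endpoints.
have uI : u <= u <= v by rewrite lexx uv.
have vI : u <= v <= v by rewrite lexx uv.
have wI : w <= w <= z by rewrite lexx wz.
have zI : w <= z <= z by rewrite lexx wz.
have [x0 x0I ->] : exists2 x0, u <= x0 <= v & Num.min (u * w) (v * w) = x0 * w.
  by case: (leP (u * w) (v * w)) => _; [exists u|exists v].
have [x1 x1I ->] : exists2 x1, u <= x1 <= v & Num.max (u * z) (v * z) = x1 * z.
  by case: (leP (u * z) (v * z)) => _; [exists v|exists u].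
(* The path from corner [(x0, w)] to [(x1, z)] turns at [(x0, z)]: values up to [x0 * z] come from
   moving the second factor, larger ones from moving the first. *)
move=> /andP[lt tr]; have [tx|/ltW tx] := leP t (x0 * z).
  have /mul_convex_ivt[s s01 <-] : x0 * w <= t <= x0 * z by rewrite lt tx.
  exists x0; first by rewrite /= in_itv.
  by exists (w + s * (z - w)) => //; rewrite /= in_itv /= convex_itv.
have /mul_convex_ivt[s s01 <-] : z * x0 <= t <= z * x1.
  by rewrite -(mulrC x0) -(mulrC x1) tx tr.
exists (x0 + s * (x1 - x0)); first by rewrite /= in_itv /= convex_itv.
by exists z; [rewrite /= in_itv|exact: mulrC].
Qed.

(** Each endpoint lies in the other segment. The hypothesis rules out the empty set, which does not
    determine its endpoints. *)
Lemma segment_inj (K : realType) (p q p' q' : K) : p' <= q' ->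
  `[p, q]%classic = `[p', q']%classic -> p = p' /\ q = q'.
Proof.
move=> pq' E.
have mem x : (p <= x <= q) = (p' <= x <= q').
  by have /= := congr1 (fun S => S x) E; rewrite !in_itv /= => H; apply/idP/idP; rewrite H.
have /andP[pp' p'q] : p <= p' <= q by rewrite mem lexx.
have /andP[pq q'q] : p <= q' <= q by rewrite mem lexx pq'.
have /andP[p'p _] : p' <= p <= q' by rewrite -mem lexx (le_trans pp').
have /andP[_ qq'] : p' <= q <= q' by rewrite -mem lexx (le_trans pp').
by split; apply/eqP; rewrite eq_le ?pp' ?qq'.
Qed.

Lemma lr_tuple_eq (K : realType) (A B : lr_tuple K) : mean A = mean B ->
  lspread A =1 lspread B -> rspread A =1 rspread B -> A = B.
Proof.
case: A B => [? ? ? ? ? ? ? ? ?] [? ? ? ? ? ? ? ? ?] /= -> El Er.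
by move: (El muL) (El muU) (El nuL) (El nuU) (Er muL) (Er muU) (Er nuL) (Er nuU)
  => /= -> -> -> -> -> -> -> ->.
Qed.

Lemma shape_le (K : realType) (f : K -> K) (x y : K) :
  shape_function f -> 0 <= x -> x <= y -> f y <= f x.
Proof.
move=> hf x0; rewrite le_eqVlt => /predU1P[->//|xy].
exact/ltW/(shape_decr hf).
Qed.

Lemma shape_scale_le (K : realType) (f : K -> K) (d s s' : K) :
  shape_function f -> 0 <= d -> 0 < s -> s <= s' -> f (d / s) <= f (d / s').
Proof.
move=> hf d0 s0 ss'; have s'0 := lt_le_trans s0 ss'.
apply: shape_le => //; first by rewrite divr_ge0 // ltW.
by rewrite ler_wpM2l // lef_pV2.
Qed.

(** Within the narrower support, widening the spread shrinks the argument and so raises the shape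
    value subtracted from 1; outside it the membership is 0 and the non-membership at most 1. *)
Lemma lr_membershipD_nonmembership_le1 (K : realType) (f g : K -> K)
    (a l r l' r' x : K) :
  shape_function f -> shape_function g ->
  0 < l -> l <= l' -> 0 < r -> r <= r' ->
  lr_membership f g a l r x + lr_nonmembership f g a l' r' x <= 1.
Proof.
move=> hf hg l0 ll' r0 rr'; rewrite /lr_membership /lr_nonmembership.
have l'0 := lt_le_trans l0 ll'; have r'0 := lt_le_trans r0 rr'.
have [xa|ax] := leP x a; last rewrite !andbF (ltW ax) /=.
- have [lx|lx] := leP (a - l) x.
    have -> /= : a - l' <= x by lra.
    have : f ((a - x) / l) <= f ((a - x) / l').
      by apply: shape_scale_le => //; lra.
    lra.
  have -> /= : (a <= x) = false by lra.
  case: ifP => [_|_]; last by rewrite add0r.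
  have /(shape_range hf)/andP[f0 _] : 0 <= (a - x) / l'.
    by rewrite divr_ge0 // ?ltW //; lra.
  lra.
- have xa0 : 0 <= x - a by lra.
  have /(shape_range hg)/andP[g0 _] : 0 <= (x - a) / r'.
    by rewrite divr_ge0 // ltW.
  have := shape_scale_le hg xa0 r0 rr'.
  have [xr|xr] := leP x (a + r); last by case: ifP; lra.
  have -> : x <= a + r' by lra.
  lra.
Qed.

(** This carries the sign hypothesis on the [nuL] interval over to the other three, which are nested
    in it. *)
Lemma spread_conditions_le_nuL (K : realType) (s : component -> K) :
  spread_conditions s -> forall k, s k <= s nuL.
Proof. by case=> [_ ? ? ? ?] [] //; lra. Qed.

Theorem proposition3p1p12 (K : realType) (L R L' R' : K -> K)
    (hL : shape_function L) (hR : shape_function R)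
    (hL' : shape_function L') (hR' : shape_function R')
    (A1 A2 : lr_tuple K)
    (hA1 : is_LR_ivifn L R L' R' A1) (hA2 : is_LR_ivifn L R L' R' A2)
    (hpos : 0 <= mean A1 - lspread A1 nuL) :
  let a1 := mean A1 in
  let a2 := mean A2 in
  let l k := a1 * a2 -
    Num.min ((a1 - lspread A1 k) * (a2 - lspread A2 k))
            ((a1 + rspread A1 k) * (a2 - lspread A2 k)) in
  let r k :=
    Num.max ((a1 - lspread A1 k) * (a2 + rspread A2 k))
            ((a1 + rspread A1 k) * (a2 + rspread A2 k)) - a1 * a2 in
  let A := LRTuple (a1 * a2) (l muL) (r muL) (l muU) (r muU)
                             (l nuL) (r nuL) (l nuU) (r nuU) in
  (forall B : lr_tuple K, is_product A1 A2 B <-> B = A) /\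
  is_LR_ivifn L R L' R' A.
Proof.
case: hA1 hA2 => sl1 sr1 _ [sl2 sr2 _] a1 a2 l r A.
have lA k : lspread A k = l k by case: k.
have rA k : rspread A k = r k by case: k.
have lk0 k : 0 <= a1 - lspread A1 k.
  by apply: le_trans hpos _; rewrite lerD2l lerN2; exact: spread_conditions_le_nuL.
have l1_gt0 k : 0 < lspread A1 k by case: sl1.
have r1_gt0 k : 0 < rspread A1 k by case: sr1.
have l2_gt0 k : 0 < lspread A2 k by case: sl2.
have r2_gt0 k : 0 < rspread A2 k by case: sr2.
have itvE k : [set x * y | x in base_interval A1 k & y in base_interval A2 k]%classic
    = base_interval A k.
  rewrite /base_interval lA rA itv_mul //.
  - by rewrite /l /r /= subKr (addrC (a1 * a2)) subrK.
  - by have := l1_gt0 k; have := r1_gt0 k; lra.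
  - by have := l2_gt0 k; have := r2_gt0 k; lra.
(* Strictness here makes the product spreads positive: moving the second factor off [a2] while the
   first stays at [a1] already changes the product. *)
have a1_gt0 : 0 < a1 by have := lk0 nuL; have := l1_gt0 nuL; lra.
have l_gt0 k : 0 < l k.
  rewrite subr_gt0 gt_min.
  have := lk0 k; have := l1_gt0 k; have := r1_gt0 k; have := l2_gt0 k => h1 h2 h3 h4.
  by case: (leP 0 (a2 - lspread A2 k)) => h; apply/orP; [left|right]; nra.
have r_gt0 k : 0 < r k.
  rewrite subr_gt0 lt_max.
  have := lk0 k; have := l1_gt0 k; have := r1_gt0 k; have := r2_gt0 k => h1 h2 h3 h4.
  by case: (leP 0 (a2 + rspread A2 k)) => h; apply/orP; [right|left]; nra.
(* Both candidate corners for [k] have their first factor in the [k'] interval and their second at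
   or above its left end, so the [k'] minimum bounds them. *)
have l_le k k' : lspread A1 k <= lspread A1 k' -> rspread A1 k <= rspread A1 k' ->
    lspread A2 k <= lspread A2 k' -> l k <= l k'.
  move=> h1 h2 h3; have := l1_gt0 k; have := r1_gt0 k => h4 h5.
  rewrite lerD2l lerN2 le_min; apply/andP; split;
    by apply: mul_ge_min_endpoints => //; lra.
have r_le k k' : lspread A1 k <= lspread A1 k' -> rspread A1 k <= rspread A1 k' ->
    rspread A2 k <= rspread A2 k' -> r k <= r k'.
  move=> h1 h2 h3; have := l1_gt0 k; have := r1_gt0 k => h4 h5.
  rewrite lerD2r ge_max; apply/andP; split;
    by apply: mul_le_max_endpoints => //; lra.
case: sl1 sr1 sl2 sr2 => [_ p1 p2 p3 p4] [_ q1 q2 q3 q4] [_ s1 s2 s3 s4] [_ t1 t2 t3 t4].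
split.
- move=> B; split=> [[mB EB]|->]; last by split=> // k; rewrite itvE.
  (* Equal endpoints together with equal means force equal spreads, hence uniqueness of the
     product. *)
  have endpoints k : mean B - lspread B k = mean A - lspread A k /\
                     mean B + rspread B k = mean A + rspread A k.
    apply: segment_inj; last exact: etrans (EB k) (itvE k).
    by rewrite lA rA; have := l_gt0 k; have := r_gt0 k; lra.
  apply: lr_tuple_eq => // k.
    by have [+ _] := endpoints k; rewrite mB => /addrI/oppr_inj.
  by have [_] := endpoints k; rewrite mB => /addrI.
- split.
  + by split=> [k|||| ]; rewrite ?lA //=; apply: l_le.
  + by split=> [k|||| ]; rewrite ?rA //=; apply: r_le.
  + by move=> x; apply: lr_membershipD_nonmembership_le1; rewrite ?lA ?rA //;
      [apply: l_le|apply: r_le].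
Qed.
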